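(* Let $K\subset\mathbb{R}^n$ be a closed convex set and $U\subset\mathbb{R}^n$ an affine subspace with $K\cap U\neq\varnothing$, and let $z\in U$ be given. Set $z_{\mathrm{MAP}}:=P_UP_K(z)$, $z_{\mathrm{DRM}}:=\frac12(\operatorname{Id}+R_UR_K)(z)$ and $C(z):=\operatorname{circumcenter}\{z,R_K(z),R_UR_K(z)\}$. Then, for any $s\in K\cap U$, we have: (i) $\|C(z)-s\|\le\|z_{\mathrm{MAP}}-s\|\le\|z_{\mathrm{DRM}}-s\|$; (ii) $\operatorname{dist}(C(z),K\cap U)\le\operatorname{dist}(z_{\mathrm{MAP}},K\cap U)\le\operatorname{dist}(z_{\mathrm{DRM}},K\cap U)$.
   Context: $\mathbb{R}^n$ carries the Euclidean norm $\|\cdot\|$, and $\operatorname{dist}(x,S)=\inf_{s\in S}\|x-s\|$. For a nonempty closed convex set $\Omega\subset\mathbb{R}^n$, $P_\Omega$ is the orthogonal projection onto $\Omega$ and $R_\Omega:=2P_\Omega-\operatorname{Id}$ is the reflection operator, where $\operatorname{Id}$ is the identity. For points $a,b,c\in\mathbb{R}^n$ (not necessarily distinct), $\operatorname{circumcenter}\{a,b,c\}$ is the point $p$ such that (i) $\|a-p\|=\|b-p\|=\|c-p\|$ and (ii) $p\in\operatorname{aff}\{a,b,c\}$, the affine hull of the three points; it is well-defined if such a point exists (it is then unique). Under the stated hypotheses, $C(z)$ is well-defined for every $z\in U$. *)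

(* Defs.v *)
From HB Require Import structures.
From mathcomp Require Import all_boot all_order all_algebra.
From mathcomp Require Import all_classical all_reals all_analysis.

Set Implicit Arguments.
Unset Strict Implicit.
Unset Printing Implicit Defensive.

Import Order.TTheory GRing.Theory Num.Theory.
Import numFieldNormedType.Exports.

Local Open Scope classical_set_scope.
Local Open Scope ring_scope.

(* Not `|x|, which on matrices is the sup norm.  The two norms induce the same
   topology, so the library's [closed] on 'rV[R]_n is the Euclidean one. *)
Definition enorm (R : realType) (n : nat) (x : 'rV[R]_n) : R :=
  Num.sqrt (\sum_(i < n) x ord0 i ^+ 2).

Definition dist (R : realType) (n : nat) (x : 'rV[R]_n)
    (S : set 'rV[R]_n) : R :=
  inf [set enorm (x - s) | s in S].

Definition affine_subspace (R : realType) (n : nat) (U : set 'rV[R]_n) : Prop :=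
  exists (a : 'rV[R]_n) (V : {vspace 'rV[R]_n}), U = [set x | x - a \in V].

Definition aff (R : realType) (n : nat) (A : set 'rV[R]_n) : set 'rV[R]_n :=
  smallest (@affine_subspace R n) A.

Definition is_proj (R : realType) (n : nat) (S : set 'rV[R]_n)
    (x p : 'rV[R]_n) : Prop :=
  S p /\ forall y, S y -> enorm (x - p) <= enorm (x - y).

(* The default value x is only taken when x has no nearest point in S, which
   cannot happen when S is nonempty, closed and convex. *)
Definition proj (R : realType) (n : nat) (S : set 'rV[R]_n)
    (x : 'rV[R]_n) : 'rV[R]_n :=
  xget x [set p | is_proj S x p].

Definition reflection (R : realType) (n : nat) (S : set 'rV[R]_n)
    (x : 'rV[R]_n) : 'rV[R]_n :=
  2 *: proj S x - x.

Definition is_circumcenter (R : realType) (n : nat) (a b c p : 'rV[R]_n) : Prop :=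
  [/\ enorm (a - p) = enorm (b - p), enorm (b - p) = enorm (c - p)
    & aff [set a; b; c] p].

(* The default value 0 is only taken when no circumcenter exists (a, b, c
   distinct and collinear). *)
Definition circumcenter (R : realType) (n : nat) (a b c : 'rV[R]_n) : 'rV[R]_n :=
  xget 0 [set p | is_circumcenter a b c p].

Definition z_MAP (R : realType) (n : nat) (K U : set 'rV[R]_n)
    (z : 'rV[R]_n) : 'rV[R]_n :=
  proj U (proj K z).

Definition z_DRM (R : realType) (n : nat) (K U : set 'rV[R]_n)
    (z : 'rV[R]_n) : 'rV[R]_n :=
  2^-1 *: (z + reflection U (reflection K z)).

Definition CRM (R : realType) (n : nat) (K U : set 'rV[R]_n)
    (z : 'rV[R]_n) : 'rV[R]_n :=
  circumcenter z (reflection K z) (reflection U (reflection K z)).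

(* Main.v *)
Require Import Defs.
From HB Require Import structures.
From mathcomp Require Import all_boot all_order all_algebra.
From mathcomp Require Import all_classical all_reals all_analysis.
From mathcomp Require Import ring lra.

(** Write [p] for the projection of [z] on [K], [w] for [z_MAP], and split the
    displacement from [z] to [p] as [u + v] with [u = w - z] parallel to [U] and
    [v = p - w] orthogonal to it.  Every point of the theorem then has an
    explicit form.  Reflecting in [K] gives [z + 2 (u + v)]; since [U] is affine,
    reflecting the result in [U] flips the sign of the orthogonal part, which
    gives [z + 2 (u - v)].  Hence [z_DRM = w - v], and the circumcenter, which
    lies on the line through [z] directed by [u], is
    [z + (1 + |v|^2 / |u|^2) u = w + (|v|^2 / |u|^2) u] ([circumcenterE]).

    Let [s] be a point of [K `&` U].  As [v] is orthogonal to [w - s], Pythagoras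
    gives the inequality between [z_MAP] and [z_DRM] ([enorm_orthB]).  For the
    other one, the angle at [p] between [z] and [s] is obtuse because [K] is
    convex ([proj_obtuse]); in terms of [u] and [v] this reads
    [<u, w - s> + |v|^2 <= 0].  So, when [u <> 0], the distance to [s] from
    [w + t u] is at most that from [w] for [0 <= t <= 2 |v|^2 / |u|^2], and the
    circumcenter has [t] in the middle of this range ([enorm_overshoot]).  The
    same inequality shows that [u = 0] forces [v = 0], so that the three points
    are then equal and the circumcenter always exists.

    The distance inequalities follow by taking infima over [s]. *)

Set Implicit Arguments.
Unset Strict Implicit.
Unset Printing Implicit Defensive.

Import Order.TTheory GRing.Theory Num.Theory.
Import numFieldNormedType.Exports.

Local Open Scope classical_set_scope.
Local Open Scope ring_scope.

(* Unqualified, [proj] denotes the projections of a dependent product. *)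
Local Notation proj := Defs.proj.

(** * The Euclidean inner product *)

Section InnerProduct.
Context {R : realType} {n : nat}.
Implicit Types (u v w x y : 'rV[R]_n) (a : R).

Definition dot u v : R := \sum_(i < n) u ord0 i * v ord0 i.

Lemma dotC u v : dot u v = dot v u.
Proof. by apply: eq_bigr => i _; rewrite mulrC. Qed.

Lemma dotDl u v w : dot (u + v) w = dot u w + dot v w.
Proof. by rewrite -big_split; apply: eq_bigr => i _; rewrite mxE mulrDl. Qed.

Lemma dotZl a u v : dot (a *: u) v = a * dot u v.
Proof. by rewrite big_distrr; apply: eq_bigr => i _; rewrite mxE /= mulrA. Qed.

Lemma dotNl u v : dot (- u) v = - dot u v.
Proof. by rewrite -scaleN1r dotZl mulN1r. Qed.

Lemma dotDr u v w : dot u (v + w) = dot u v + dot u w.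
Proof. by rewrite dotC dotDl !(dotC u). Qed.

Lemma dotZr a u v : dot u (a *: v) = a * dot u v.
Proof. by rewrite dotC dotZl dotC. Qed.

Lemma dotNr u v : dot u (- v) = - dot u v.
Proof. by rewrite dotC dotNl dotC. Qed.

Lemma dot0l u : dot 0 u = 0.
Proof. by rewrite -(scale0r 0) dotZl mul0r. Qed.

Definition dotE := (dotDl, dotDr, dotNl, dotNr, dotZl, dotZr).

Lemma dot_subZ a u v :
  dot (u - a *: v) (u - a *: v) = dot u u - 2 * a * dot u v + a ^+ 2 * dot v v.
Proof. by rewrite !dotE (dotC v u); ring. Qed.

Lemma dot_ge0 u : 0 <= dot u u.
Proof. by apply: sumr_ge0 => i _; rewrite -expr2 sqr_ge0. Qed.

Lemma dot_eq0 u : dot u u = 0 -> u = 0.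
Proof.
move=> /psumr_eq0P u0; apply/rowP => i; rewrite mxE; apply/eqP.
by rewrite -sqrf_eq0 expr2 u0// => j _; rewrite -expr2 sqr_ge0.
Qed.

Lemma enormE u : enorm u = Num.sqrt (dot u u).
Proof. by congr Num.sqrt; apply: eq_bigr => i _; rewrite expr2. Qed.

Lemma ler_enorm u v : (enorm u <= enorm v) = (dot u u <= dot v v).
Proof. by rewrite !enormE ler_sqrt// dot_ge0. Qed.

Lemma enorm_inj u v : enorm u = enorm v -> dot u u = dot v v.
Proof. by move=> uv; apply/eqP; rewrite eq_le -!ler_enorm uv lexx. Qed.

(** Compactness criteria speak of the sup norm of matrices; this bound transfers
    Euclidean boundedness to it. *)
Lemma mx_norm_le_enorm u : `|u| <= enorm u.
Proof.
rewrite [leLHS]mx_normrE.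
apply: bigmax_le => [|[i j] _]; first exact: sqrtr_ge0.
rewrite ord1 /= -sqrtr_sqr ler_sqrt; last first.
  by apply: sumr_ge0 => k _; exact: sqr_ge0.
by rewrite (bigD1 j)//= lerDl; apply: sumr_ge0 => k _; exact: sqr_ge0.
Qed.

Lemma continuous_linear_form u : continuous (fun x => dot x u).
Proof.
apply: continuous_big => [|i _ x]; first exact: add_continuous.
exact: (cvgM (@coord_continuous _ _ _ ord0 i x) (cvg_cst _)).
Qed.

Lemma continuous_enormB x : continuous (fun y => enorm (x - y)).
Proof.
move=> y; under [X in continuous_at _ X]eq_fun do rewrite enormE.
apply: continuous_comp; last exact: sqrt_continuous.
have coordB i : continuous (fun y => (x - y) ord0 i).
  move=> {}y; under [X in continuous_at _ X]eq_fun do rewrite !mxE.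
  exact: (cvgB (cvg_cst _) (@coord_continuous _ _ _ ord0 i y)).
apply: continuous_big => [|i _ {}y]; first exact: add_continuous.
exact: (cvgM (coordB i y) (coordB i y)).
Qed.

End InnerProduct.

(** * Projections on closed convex sets *)

Section Projection.
Context {R : realType} {n : nat}.
Implicit Types (S U : set 'rV[R]_n) (x y p : 'rV[R]_n).

(** A nearest point of [S] is to be found among the points of [S] that are no
    farther from [x] than a given one: a compact set, on which the distance to
    [x] attains its minimum. *)
Lemma proj_is_proj S x : closed S -> S !=set0 -> is_proj S x (proj S x).
Proof.
move=> Scl [y0 Sy0].
pose A := S `&` [set y | enorm (x - y) <= enorm (x - y0)].
have Acl : closed A.
  apply: closedI => //.
  apply: (@preimage_closed _ _ (fun y => enorm (x - y)) [set r | r <= _]).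
    by move=> y _; exact: continuous_enormB.
  exact: closed_le.
have Abd : bounded_set A.
  exists (`|x| + enorm (x - y0)); split; first exact: num_real.
  move=> M /ltW MM y [_ /= yy0]; apply: le_trans MM.
  rewrite -[y in leLHS](subKr x) (le_trans (ler_normB _ _))// lerD2l.
  exact: le_trans (mx_norm_le_enorm _) yy0.
have A0 : A !=set0 by exists y0; split => //=.
have Acpt := bounded_closed_compact Abd Acl.
have [] := EVT_min_rV (f := fun y => enorm (x - y)) A0 Acpt.
  by apply: continuous_subspaceT; exact: continuous_enormB.
move=> p /set_mem[Sp pp0] pmin; apply: (@xgetPex _ x [set q | is_proj S x q]).
exists p; split => // y Sy.
have [yy0|/ltW yy0] := leP (enorm (x - y)) (enorm (x - y0)).
  by apply: pmin; apply/mem_set.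
exact: le_trans pp0 yy0.
Qed.

(** If the angle at [p] were acute, a short step from [p] towards [y] would stay
    in [S] and come closer to [x]: a step of length [t] changes the squared
    distance by [- 2 t d + t^2 e]. *)
Lemma proj_obtuse S x p y : convex_set S -> is_proj S x p -> S y ->
  dot (x - p) (y - p) <= 0.
Proof.
move=> Scv [Sp pmin] Sy; set d := dot _ _; set e := dot (y - p) (y - p).
have e0 : 0 <= e by exact: dot_ge0.
have small (t : R) : 0 < t -> t <= 1 -> 2 * d <= t * e.
  move=> t0 t1; have cS : S (t *: y + (1 - t) *: p).
    by have /set_mem := Scv y p (Itv01 (ltW t0) t1) (mem_set Sy) (mem_set Sp).
  have := pmin _ cS; rewrite ler_enorm.
  have -> : x - (t *: y + (1 - t) *: p) = (x - p) - t *: (y - p).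
    by apply/rowP => i; rewrite !mxE; ring.
  rewrite dot_subZ -/d -/e => le_t.
  by rewrite -(ler_pM2l t0); lra.
have [//|d0] := leP d 0.
(* The step d / e would be optimal; d / (e + d) is in addition at most 1. *)
have ed : 0 < e + d by lra.
have := small (d / (e + d)); rewrite divr_gt0// ler_pdivrMr// mul1r.
rewrite lerDr e0 mulrAC ler_pdivlMr// => /(_ isT isT); nra.
Qed.

End Projection.

(** * Projections on affine subspaces *)

Section Affine.
Context {R : realType} {n : nat}.
Implicit Types (a x y p w : 'rV[R]_n) (V : {vspace 'rV[R]_n}).

(** [V] is the kernel of the matrix of [projv V - 1], hence an intersection of
    zero sets of linear forms. *)
Lemma closed_affine a V : closed [set x | x - a \in V].
Proof.
pose M := lin1_mx (projv V) - 1%:M.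
have ME y : (y *m M = 0) <-> (y \in V).
  rewrite mulmxBr mulmx1 mul_rV_lin1; split => [/subr0_eq <-|yV].
    exact: memv_proj.
  by apply/eqP; rewrite subr_eq0; apply/eqP; exact: projv_id.
have -> : [set x | x - a \in V] =
    \bigcap_(j in [set: 'I_n]) [set x | dot x (col j M)^T = dot a (col j M)^T].
  have dotM y j : dot y (col j M)^T = (y *m M) ord0 j.
    by rewrite [RHS]mxE; apply: eq_bigr => i _; rewrite !mxE.
  apply/seteqP; split => x /= xa.
    move=> j _ /=; apply: subr0_eq; rewrite -dotNl -dotDl dotM.
    by rewrite (ME _).2// mxE.
  apply/ME/rowP => j; have /= /eqP := xa j I.
  by rewrite -subr_eq0 -dotNl -dotDl dotM => /eqP ->; rewrite mxE.
apply: closed_bigI => j _.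
apply: (@preimage_closed _ _ (fun x => dot x _) [set r | r = _]).
  by move=> y _; exact: continuous_linear_form.
exact: closed_eq.
Qed.

Lemma convex_affine a V : convex_set [set x | x - a \in V].
Proof.
move=> x y t /set_mem /= xV /set_mem /= yV; apply/mem_set => /=.
have -> : conv t x y - a = t%:num *: (x - a) + (1 - t%:num) *: (y - a).
  rewrite /conv /=; apply/rowP => i; rewrite !mxE /unstable.onem; ring.
by rewrite memvD// memvZ.
Qed.

(** The obtuse angle inequality holds for both [v] and [- v]. *)
Lemma proj_affine_orth a V x v : v \in V ->
  dot (x - proj [set y | y - a \in V] x) v = 0.
Proof.
move=> vV; set U := [set y | _].
have U0 : U !=set0 by exists a; rewrite /U /= subrr mem0v.
have projU := proj_is_proj x (@closed_affine a V) U0; have [pU _] := projU.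
have obt := proj_obtuse (@convex_affine a V) projU.
have le0 t : t \in V -> dot (x - proj U x) t <= 0.
  move=> tV; rewrite -[t](addrK (proj U x)); apply: obt => /=.
  by rewrite -addrA memvD.
apply/eqP; rewrite eq_le le0//=.
by rewrite -oppr_le0 -dotNr le0// memvN.
Qed.

Lemma proj_affineE a V x w : w - a \in V ->
  (forall v, v \in V -> dot (x - w) v = 0) ->
  proj [set y | y - a \in V] x = w.
Proof.
move=> wV worth; have orth := @proj_affine_orth a V x.
set U := [set y | _] in orth *.
have U0 : U !=set0 by exists a; rewrite /U /= subrr mem0v.
have [pU _] := proj_is_proj x (@closed_affine a V) U0.
have dV : proj U x - w \in V by rewrite -(subrKA a) memvD// -opprB memvN.
apply: subr0_eq; apply: dot_eq0.
have := worth _ dV; have := orth _ dV; rewrite !dotE; lra.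
Qed.

End Affine.

(** * The circumcenter *)

Section Circumcenter.
Context {R : realType} {n : nat}.
Implicit Types (a b c p z u v : 'rV[R]_n).

(** The right-hand side describes the translate to [a] of the span of [b - a] and
    [c - a], and every affine subspace through the three points contains it. *)
Lemma aff3P a b c p : aff [set a; b; c] p <->
  exists l m : R, p = a + l *: (b - a) + m *: (c - a).
Proof.
split.
  pose V := (<[b - a]> + <[c - a]>)%VS.
  move/(_ [set x | x - a \in V]) => inV.
  have /inV /= : affine_subspace [set x | x - a \in V] /\
      [set a; b; c] `<=` [set x | x - a \in V].
    split; first by exists a, V.
    move=> _ [[]|] -> /=; first by rewrite subrr mem0v.
      by rewrite (subvP (addvSl _ _))// memv_line.
    by rewrite (subvP (addvSr _ _))// memv_line.
  move=> /memv_addP[_ /vlineP[l ->] [_ /vlineP[m ->]]] /(canRL (subrK _)) ->.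
  by exists l, m; rewrite addrC addrA.
move=> [l [m ->]] _ [[d [V ->]] abc] /=.
have aV : a - d \in V by apply: abc; left; left.
have bV : b - d \in V by apply: abc; left; right.
have cV : c - d \in V by apply: abc; right.
have -> : a + l *: (b - a) + m *: (c - a) - d =
    (a - d) + l *: ((b - d) - (a - d)) + m *: ((c - d) - (a - d)).
  by apply/rowP => i; rewrite !mxE; ring.
by apply: memvD; [apply: memvD => //|]; apply: memvZ; exact: memvB.
Qed.

(** For a point [z + s u + t v], being equidistant from the last two points says
    [t |v|^2 = 0], and being equidistant from the first two then says
    [s |u|^2 = |u|^2 + |v|^2].  When [u = v = 0] the three points coincide and
    the quotient, with zero denominator, is multiplied by [u = 0]. *)
Lemma circumcenterP z u v p : dot u v = 0 -> (u = 0 -> v = 0) ->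
  is_circumcenter z (z + 2 *: (u + v)) (z + 2 *: (u - v)) p <->
  p = z + (1 + dot v v / dot u u) *: u.
Proof.
move=> uv u0v0; have uvE := (uv, dotC v u).
have addKB x y : z + x - (z + y) = x - y by rewrite opprD addrACA subrr add0r.
have subz x : z - (z + x) = - x by rewrite opprD addNKr.
have [u0|uN0] := eqVneq u 0.
  rewrite (u0v0 u0) u0 subr0 addr0 !scaler0 !addr0; split.
    by move=> [_ _ /aff3P[l [m ->]]]; rewrite subrr !scaler0 !addr0.
  move=> ->; split => //; apply/aff3P; exists 0, 0.
  by rewrite !scale0r !addr0.
have uu0 : dot u u != 0 by apply: contra_neq uN0; exact: dot_eq0.
split.
  move=> [/enorm_inj eqab /enorm_inj eqbc /aff3P[l [m pE]]].
  pose s := 2 * (l + m); pose t := 2 * (l - m).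
  have {}pE : p = z + (s *: u + t *: v).
    by rewrite pE; apply/rowP => i; rewrite !mxE /s /t; ring.
  move: eqab eqbc; rewrite {}pE subz !addKB !dotE !uvE => eqab eqbc.
  have tv0 : t * dot v v = 0 by lra.
  have -> : s = 1 + dot v v / dot u u.
    by apply: (mulIf uu0); rewrite mulrDl divfK// mul1r; lra.
  suff -> : t *: v = 0 by rewrite addr0.
  by apply: dot_eq0; rewrite dotZl dotZr tv0 mulr0.
move=> ->; set s := 1 + _.
have suu : s * dot u u = dot u u + dot v v by rewrite mulrDl divfK// mul1r.
split.
- rewrite !enormE subz addKB.
  congr Num.sqrt; rewrite !dotE !uvE; lra.
- rewrite !enormE !addKB.
  congr Num.sqrt; rewrite !dotE !uvE; lra.
- apply/aff3P; exists (s / 4), (s / 4).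
  by apply/rowP => i; rewrite !mxE; field.
Qed.

Lemma circumcenterE z u v : dot u v = 0 -> (u = 0 -> v = 0) ->
  circumcenter z (z + 2 *: (u + v)) (z + 2 *: (u - v)) =
  z + (1 + dot v v / dot u u) *: u.
Proof.
move=> uv u0v0; apply: xget_unique => [|p]; first exact/circumcenterP.
by move/circumcenterP; exact.
Qed.

End Circumcenter.

(** * Comparison of the three steps *)

Section Comparison.
Context {R : realType} {n : nat}.
Implicit Types u v d : 'rV[R]_n.

Lemma enorm_orthB d v : dot v d = 0 -> enorm d <= enorm (d - v).
Proof.
by move=> vd; rewrite ler_enorm !dotE (dotC d) vd; have := dot_ge0 v; lra.
Qed.

(** With [t = |v|^2 / |u|^2], the squared norm changes by
    [2 t <u, d> + t^2 |u|^2 = t (2 <u, d> + |v|^2) <= - t |v|^2].  If [u = 0],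
    then [t = 0] and nothing moves. *)
Lemma enorm_overshoot u v d : dot u d + dot v v <= 0 ->
  enorm (d + (dot v v / dot u u) *: u) <= enorm d.
Proof.
move=> ud; rewrite ler_enorm !dotE (dotC d).
have vv0 := dot_ge0 v; have uu0 := dot_ge0 u.
have [->|uuN0] := eqVneq (dot u u) 0; first by rewrite invr0; lra.
set t := dot v v / dot u u.
have t0 : 0 <= t by exact: divr_ge0.
have tuu : t * dot u u = dot v v by rewrite divfK.
rewrite tuu; nra.
Qed.

End Comparison.

Lemma dist_le (R : realType) (n : nat) (S : set 'rV[R]_n) (x y : 'rV[R]_n) :
  S !=set0 -> (forall s, S s -> enorm (x - s) <= enorm (y - s)) ->
  dist x S <= dist y S.
Proof.
move=> [s0 Ss0] xy; apply: lb_le_inf; first by exists (enorm (y - s0)), s0.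
move=> _ [s Ss <-]; apply: le_trans (xy _ Ss); apply: ge_inf; last by exists s.
by exists 0 => _ [t _ <-]; exact: sqrtr_ge0.
Qed.

Theorem theorem2 (R : realType) (n : nat) (K U : set 'rV[R]_n)
    (hKclosed : closed K) (hKconvex : convex_set K)
    (hU : affine_subspace U) (hKU : K `&` U !=set0)
    (z : 'rV[R]_n) (hz : U z)
    (s : 'rV[R]_n) (hs : (K `&` U) s) :
  (enorm (CRM K U z - s) <= enorm (z_MAP K U z - s) /\
   enorm (z_MAP K U z - s) <= enorm (z_DRM K U z - s)) /\
  (dist (CRM K U z) (K `&` U) <= dist (z_MAP K U z) (K `&` U) /\
   dist (z_MAP K U z) (K `&` U) <= dist (z_DRM K U z) (K `&` U)).
Proof.
have [a [V UE]] := hU.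
have key t : (K `&` U) t ->
    enorm (CRM K U z - t) <= enorm (z_MAP K U z - t) /\
    enorm (z_MAP K U z - t) <= enorm (z_DRM K U z - t).
  move=> [Kt Ut]; rewrite /CRM /z_MAP /z_DRM /reflection.
  have K0 : K !=set0 by exists t.
  have U0 : U !=set0 by exists t.
  have Ucl : closed U by rewrite UE; exact: closed_affine.
  set p := proj K z; set w := proj U p.
  have Uw : U w by have [] := proj_is_proj p Ucl U0.
  have UB x y : U x -> U y -> x - y \in V.
    by rewrite UE /= => xa ya; rewrite -(subrKA a) -(opprB y) memvB.
  set u := w - z; set v := p - w.
  have vV x : x \in V -> dot v x = 0.
    by rewrite /v /w UE; exact: proj_affine_orth.
  have -> : proj U (2 *: p - z) = 2 *: w - z.
    rewrite UE; apply: proj_affineE => [|x xV].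
      have -> : 2 *: w - z - a = (w - a) + (w - z).
        by apply/rowP => i; rewrite !mxE; ring.
      by apply: memvD; [move: Uw; rewrite UE | exact: UB].
    have -> : 2 *: p - z - (2 *: w - z) = 2 *: v.
      by apply/rowP => i; rewrite !mxE; ring.
    by rewrite dotZl vV// mulr0.
  have uV : u \in V by exact: UB.
  have dV : w - t \in V by exact: UB.
  have uv0 : dot u v = 0 by rewrite dotC vV.
  have ud : dot u (w - t) + dot v v <= 0.
    have := proj_obtuse hKconvex (proj_is_proj z hKclosed K0) Kt.
    rewrite -/p (_ : z - p = - (u + v)); last first.
      by apply/rowP => i; rewrite !mxE; ring.
    rewrite (_ : t - p = - ((w - t) + v)); last first.
      by apply/rowP => i; rewrite !mxE; ring.
    rewrite dotNl dotNr opprK dotDl !(dotDr _ (w - t)).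
    by rewrite uv0 (vV _ dV) addr0 add0r.
  have u0v0 : u = 0 -> v = 0.
    move=> u0; apply: dot_eq0; apply/eqP; rewrite eq_le dot_ge0 andbT.
    by move: ud; rewrite u0 dot0l add0r.
  have -> : 2 *: p - z = z + 2 *: (u + v).
    by apply/rowP => i; rewrite !mxE; ring.
  have -> : 2 *: (2 *: w - z) - (z + 2 *: (u + v)) = z + 2 *: (u - v).
    by apply/rowP => i; rewrite !mxE; ring.
  rewrite circumcenterE//; split.
    rewrite (_ : _ - t = (w - t) + (dot v v / dot u u) *: u).
      exact: enorm_overshoot.
    by apply/rowP => i; rewrite /u !mxE; ring.
  rewrite (_ : _ *: _ - t = (w - t) - v); first by apply: enorm_orthB; exact: vV.
  by apply/rowP => i; rewrite !mxE; field.
split; first exact: key.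
by split; apply: dist_le => // t /key[].
Qed.
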